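(* Let $(A,\cdot)$ be an algebra. The following assertions are equivalent: (a) $(A,\cdot)$ is an $\mathcal{A}\mathrm{BD}$-algebra; (b) $(A,\cdot)$ is a Jacobi-Jordan-admissible algebra and $L_x$ is an antiderivation of $A^+$ for all $x\in A$; (c) $(A,\cdot)$ is a Jacobi-Jordan-admissible algebra and $R_x$ is an antiderivation of $A^+$ for all $x\in A$.
   Context: All algebras are over $\mathbb{C}$; an algebra $(A,\cdot)$ is a vector space with a bilinear (not necessarily associative) multiplication. Write $x\circ y = x\cdot y+y\cdot x$ and $A^+=(A,\circ)$. $L_x(t)=x\cdot t$ and $R_x(t)=t\cdot x$ are the left and right multiplications in $(A,\cdot)$. A Jacobi-Jordan algebra is a commutative algebra satisfying the Jacobi identity $x(yz)+y(zx)+z(xy)=0$. $(A,\cdot)$ is Jacobi-Jordan-admissible if $A^+$ is a Jacobi-Jordan algebra. An antiderivation of an algebra $(B,\ast)$ is a linear map $\varphi:B\to B$ with $\varphi(x\ast y)=-\big(\varphi(x)\ast y+x\ast\varphi(y)\big)$ for all $x,y$. An algebra $(A,\cdot)$ is called an $\mathcal{A}\mathrm{BD}$-algebra (algebra of anti-biderivation-type) if for all $x,y,z\in A$: $x\cdot(y\circ z) = -\big((x\cdot y)\circ z+y\circ(x\cdot z)\big)$ and $(y\circ z)\cdot x=-\big((y\cdot x)\circ z+y\circ(z\cdot x)\big)$. *)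

(* Defs.v *)
From HB Require Import structures.
From mathcomp Require Export all_boot all_order all_algebra.
From mathcomp Require Export sesquilinear.
From mathcomp Require Export complex.
From mathcomp Require Export reals.

Set Implicit Arguments.
Unset Strict Implicit.
Unset Printing Implicit Defensive.

Import GRing.Theory.
Local Open Scope ring_scope.

(* A (nonassociative) algebra structure on the vector space A: a bare bilinear
   product. The ring structures of the library are not used, since they all
   impose associativity and a unit. *)
Notation product A := {bilinear A -> A -> A}.

Section NonassociativeAlgebras.
Variables (K : comNzRingType) (A : lmodType K).
Implicit Types m : product A.

Definition circ m : A -> A -> A := fun x y => m x y + m y x.

Fact circ_bilinear m :
  bilinear_for ( *:%R : GRing.Scale.law K A) ( *:%R : GRing.Scale.law K A)
    (circ m).
Proof.
by split=> y a u v; rewrite /circ linearPl linearPr /= scalerDr addrACA.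
Qed.

HB.instance Definition _ m :=
  bilinear_isBilinear.Build K A A A *:%R *:%R (circ m) (circ_bilinear m).

Definition Lmul m (x : A) : {linear A -> A} := m x.
Definition Rmul m (x : A) : {linear A -> A} := applyr m x.

Lemma LmulE m x t : Lmul m x t = m x t. Proof. by []. Qed.
Lemma RmulE m x t : Rmul m x t = m t x. Proof. by []. Qed.

Definition jacobi_jordan m : Prop :=
  commutative m /\
  forall x y z, m x (m y z) + m y (m z x) + m z (m x y) = 0.

Definition jacobi_jordan_admissible m : Prop := jacobi_jordan (circ m).

Definition antiderivation m (phi : {linear A -> A}) : Prop :=
  forall x y, phi (m x y) = - (m (phi x) y + m x (phi y)).

Definition ABD_algebra m : Prop :=
  forall x y z,
    m x (circ m y z) = - (circ m (m x y) z + circ m y (m x z)) /\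
    m (circ m y z) x = - (circ m (m y x) z + circ m y (m z x)).

End NonassociativeAlgebras.

(* Main.v *)
Require Import Defs.
Import GRing.Theory.
Local Open Scope ring_scope.
Local Open Scope complex_scope.

(** For a commutative product, the Jacobi identity says that every
    multiplication operator is an antiderivation.  In A^+ this operator is
    L_x + R_x, and antiderivations form a vector space: hence any two of "A^+ is
    Jacobi-Jordan", "every L_x is an antiderivation" and "every R_x is an
    antiderivation" imply the third, and (a) is the conjunction of the last
    two. *)

Section Antiderivations.
Set Implicit Arguments.
Unset Strict Implicit.

Variables (K : comNzRingType) (A : lmodType K).
Implicit Types (m : product A) (phi psi chi : {linear A -> A}).

Lemma circC m : commutative (circ m).
Proof. by move=> x y; rewrite /circ addrC. Qed.

(** The equation for [chi] is only pointwise, so it applies directly to [Lmul] and [Rmul]. *)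
Lemma antiderivation_lin m (a : K) phi psi chi :
  (forall t, chi t = a *: phi t + psi t) ->
  antiderivation m phi -> antiderivation m psi -> antiderivation m chi.
Proof.
move=> chiE phiA psiA x y; rewrite !chiE phiA psiA linearPl linearPr /=.
by rewrite scalerN scalerDr -opprD addrACA.
Qed.

Lemma jacobi_jordanE m : commutative m ->
  jacobi_jordan m <-> forall x, antiderivation m (Lmul m x).
Proof.
move=> mC; split=> [[_ jac] x y z | anti].
  (* With all terms on one side, commutativity turns the sum into the cyclic Jacobi sum. *)
  apply/eqP; rewrite -addr_eq0 !LmulE (mC (m x y)) (mC x z) (addrC (m z _)).
  by rewrite addrA jac.
split=> // x y z; apply/eqP.
rewrite -addrA addr_eq0 -LmulE anti !LmulE (mC (m x y)) (mC z x).
by rewrite (addrC (m z _)).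
Qed.

Lemma admissibleE m :
  jacobi_jordan_admissible m <->
  forall x, antiderivation (circ m) (Lmul (circ m) x).
Proof. exact: jacobi_jordanE (circC m). Qed.

(** For fixed [x] the two identities unfold to the two antiderivation conditions. *)
Lemma ABD_algebraE m :
  ABD_algebra m <->
  (forall x, antiderivation (circ m) (Lmul m x)) /\
  (forall x, antiderivation (circ m) (Rmul m x)).
Proof.
split=> [abd | [antiL antiR] x y z]; last by split; [apply: antiL|apply: antiR].
by split=> x y z; case: (abd x y z).
Qed.

End Antiderivations.

Theorem proposition25 (R : realType) (A : lmodType R[i]) (mul : product A) :
  [<-> ABD_algebra mul;
       jacobi_jordan_admissible mul /\
         (forall x : A, antiderivation (circ mul) (Lmul mul x));
       jacobi_jordan_admissible mul /\
         (forall x : A, antiderivation (circ mul) (Rmul mul x))].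
Proof.
tfae.
- move=> /ABD_algebraE[antiL antiR]; split=> //; apply/admissibleE => x.
  apply: (antiderivation_lin (a := 1) _ (antiL x) (antiR x)) => t.
  by rewrite scale1r.
- move=> [/admissibleE antiC antiL]; split=> [|x]; first exact/admissibleE.
  (* R_x = -L_x + (L_x + R_x). *)
  apply: (antiderivation_lin (a := -1) _ (antiL x) (antiC x)) => t.
  by rewrite scaleN1r !LmulE RmulE /circ addKr.
- move=> [/admissibleE antiC antiR]; apply/ABD_algebraE; split=> // x.
  (* Symmetrically, L_x = -R_x + (L_x + R_x). *)
  apply: (antiderivation_lin (a := -1) _ (antiR x) (antiC x)) => t.
  by rewrite scaleN1r !LmulE RmulE /circ addrC addrK.
Qed.
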